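(* Let $p > 0$ be a real number and let $A$ be a complex $n \times n$ matrix whose spectrum belongs to $$\mathcal{P}_i = \left\{\lambda \in \mathbb{C} : (\mathrm{Im}\,\lambda)^2 < 2p\, \mathrm{Re}\, \lambda \right\}.$$ Let $H = H^* > 0$ be a solution to $$HA + A^*H - \frac{1}{2p}A^*HA + \frac{1}{4p}\left(HA^2+(A^* )^2H\right) = I.$$ If $B$ is a complex $n \times n$ matrix such that $$HB + B^*H - \frac{1}{2p}\left(A^*HB + B^*HA + B^*HB\right) + \frac{1}{4p}\left(H(AB + BA + B^2) + (AB + BA + B^2)^*H\right) > -I,$$ then for every complex $n \times n$ matrix $C$ the matrix equation $$X(A + B) + (A + B)^*X - \frac{1}{2p}(A + B)^*X(A + B) + \frac{1}{4p}\left(X(A + B)^2 + (A^* + B^* )^2X\right) = C$$ has a unique solution $X$ among complex $n \times n$ matrices.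
   Context: $M^*$ denotes the conjugate transpose of $M$, and $I$ is the $n\times n$ identity matrix. For Hermitian matrices $M, N$, $M > 0$ means that $M$ is positive definite and $M > N$ means that $M - N$ is positive definite. *)

(* Defs.v *)
From HB Require Import structures.
From mathcomp Require Import all_boot all_order all_algebra.
From mathcomp Require Import reals complex.

Set Implicit Arguments.
Unset Strict Implicit.
Unset Printing Implicit Defensive.

Import Order.TTheory GRing.Theory Num.Theory.
Local Open Scope ring_scope.
Local Open Scope complex_scope.
Local Open Scope sesquilinear_scope.

(* The order of R[i] is partial: 0 < z says that z is real and positive. *)
Definition posdefmx (R : realType) (n : nat) (M : 'M[R[i]]_n) : Prop :=
  M \is hermsymmx /\
  forall v : 'cV[R[i]]_n, v != 0 -> 0 < (v ^t* *m M *m v) 0 0.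

(* M > N; only used for Hermitian M and N. *)
Definition loewner_gt (R : realType) (n : nat) (M N : 'M[R[i]]_n) : Prop :=
  posdefmx (M - N).

Definition parabola_interior (R : realType) (p : R) (z : R[i]) : Prop :=
  complex.Im z ^+ 2 < 2 * p * complex.Re z.

(* Main.v *)
Require Import Defs.
From HB Require Import structures.
From mathcomp Require Import all_boot all_order all_algebra.
From mathcomp Require Import reals complex.
From mathcomp Require Import ring lra.

Set Implicit Arguments.
Unset Strict Implicit.
Unset Printing Implicit Defensive.

Import Order.TTheory GRing.Theory Num.Theory.
Local Open Scope ring_scope.
Local Open Scope complex_scope.
Local Open Scope sesquilinear_scope.

(** Adding the equation for [H] to the hypothesis on [B] shows that [M = A + B]
    satisfies the Lyapunov inequality [L_M(H) > 0].  Testing it on an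
    eigenvector of [M] for [z] gives [<Hv, v> (2 Re z - (Im z)^2 / p) > 0], so
    the spectrum of [M], hence that of [M^*], lies in the parabola.  The
    operator of the matrix equation is a polynomial in the commuting maps
    [X |-> X M] and [X |-> M^* X]; a singular one would have in its kernel a
    common eigenvector, with eigenvalues [a] of [M] and [b] of [M^*] such that
    [a + b + (a - b)^2 / (4 p) = 0], which is impossible inside the parabola. *)

(** The kernel of [W] is nonzero and stable under [F] and [G], which commute with [W]. Their
    restrictions to it commute, hence share an eigenvector over an algebraically closed field. *)
Lemma commuting_eigenvector_ker (C : numClosedFieldType) N (W F G : 'M[C]_N) :
    F *m G = G *m F -> F *m W = W *m F -> G *m W = W *m G -> ~~ row_free W ->
  exists v : 'rV_N, exists a, exists b,
    [/\ v != 0, v *m W = 0, v *m F = a *: v & v *m G = b *: v].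
Proof.
move=> FG FW GW; rewrite -kermx_eq0 -mxrank_eq0 -lt0n => rk_gt0.
set U := row_base (kermx W).
have Ufree : row_free U by exact: row_base_free.
have UW : U *m W = 0 by apply/sub_kermxP; rewrite eq_row_base.
(* The rows of [U] form a basis of the kernel, and [T'] is the matrix of the restriction of [T] in
   this basis. *)
have stab T : T *m W = W *m T -> exists T', U *m T = T' *m U.
  move=> TW; apply/submxP; rewrite eq_row_base; apply/sub_kermxP.
  by rewrite -mulmxA TW mulmxA UW mul0mx.
clearbody U.
have [F' F'U] := stab F FW; have [G' G'U] := stab G GW.
have F'G' : F' *m G' = G' *m F'.
  apply: (row_free_inj Ufree) => /=; rewrite -!mulmxA -G'U -F'U !mulmxA -G'U -F'U.
  by rewrite -!mulmxA FG.
have [v v_neq0 /andP[/sub_rVP[a va] /sub_rVP[b vb]]] :=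
  common_eigenvector2 rk_gt0 F'G'.
exists (v *m U), a, b; split.
- apply: contraNneq v_neq0 => vU0.
  by apply/eqP/(row_free_inj Ufree); rewrite vU0 mul0mx.
- by rewrite -mulmxA UW mulmx0.
- by rewrite -mulmxA F'U mulmxA va scalemxAl.
- by rewrite -mulmxA G'U mulmxA vb scalemxAl.
Qed.

(** On a common eigenvector of [F] and [G] the polynomial acts as the scalar assumed nonzero, so no
    such vector lies in its kernel. *)
Lemma row_free_quadratic (C : numClosedFieldType) N (c d : C)
    (F G : 'M[C]_N) :
    F *m G = G *m F ->
    (forall a b, eigenvalue F a -> eigenvalue G b ->
       a + b - c * (b * a) + d * (a ^+ 2 + b ^+ 2) != 0) ->
  row_free (F + G - c *: (F *m G) + d *: (F ^+ 2 + G ^+ 2)).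
Proof.
move=> FG spec; apply: contraT; set W := (X in row_free X).
have commW T : T *m F = F *m T -> T *m G = G *m T -> T *m W = W *m T.
  move=> TF TG; rewrite /W !expr2 -!mulmxE.
  rewrite !(mulmxDl, mulmxDr, mulNmx, mulmxN) -!(scalemxAl, scalemxAr).
  rewrite !(mulmxDl, mulmxDr).
  by rewrite !mulmxA TF TG -!(mulmxA F T) -!(mulmxA G T) TF TG !mulmxA.
have FW : F *m W = W *m F by exact: commW.
have GW : G *m W = W *m G by exact: commW.
move=> /(commuting_eigenvector_ker FG FW GW)[v [a [b [v0 vW va vb]]]].
have Fa : eigenvalue F a by apply/eigenvalueP; exists v.
have Gb : eigenvalue G b by apply/eigenvalueP; exists v.
suff vE : v *m W = (a + b - c * (b * a) + d * (a ^+ 2 + b ^+ 2)) *: v.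
  by move: (spec a b Fa Gb) vW; rewrite vE => /negPf ne0 /eqP;
     rewrite scaler_eq0 ne0 (negPf v0).
rewrite /W !expr2 -!mulmxE !(mulmxDr, mulmxN) -!scalemxAr !mulmxDr !mulmxA.
rewrite !va !vb -!scalemxAl !va !vb !scalerA scalerDr !scalerA.
rewrite -scaleNr -!scalerDl; congr (_ *: _); ring.
Qed.

Lemma eigenvalue_trmx (F : fieldType) n (M : 'M[F]_n) a :
  eigenvalue M^T a = eigenvalue M a.
Proof.
rewrite /eigenvalue /eigenspace !kermx_eq0 /row_free.
by rewrite -(mxrank_tr (M - a%:M)) linearB /= tr_scalar_mx.
Qed.

Lemma lin_mulmx_mulmxr_comm (C : comNzRingType) m n (M : 'M[C]_n) (L : 'M_m) :
  lin_mulmxr M *m lin_mulmx L = lin_mulmx L *m lin_mulmxr M.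
Proof.
apply/row_matrixP => i; rewrite !rowE -[delta_mx _ _]vec_mxK.
move: (vec_mx _) => X; rewrite !(mulmxA (mxvec X)) !mul_vec_lin /=.
by rewrite mulmxA.
Qed.

(** An eigenvector is a nonzero matrix [X] with [X *m M = a *: X]; any nonzero row of [X] is an
    eigenvector of [M]. *)
Lemma eigenvalue_lin_mulmxr (F : fieldType) m n (M : 'M[F]_n) a :
  eigenvalue (lin_mulmxr M : 'M_(m * n)) a -> eigenvalue M a.
Proof.
case/eigenvalueP => w; rewrite -[w]vec_mxK mul_vec_lin /= -linearZ /=.
move: (vec_mx w) => X /(can_inj mxvecK) XM X0.
have /row_subPn[i Xi0] : ~~ (X <= (0 : 'M_n))%MS.
  by apply: contraNN X0; rewrite submx0 => /eqP->; rewrite linear0.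
apply/eigenvalueP; exists (row i X); first by rewrite -row_mul XM linearZ.
by rewrite -submx0.
Qed.

Lemma eigenvalue_lin_mulmx (F : fieldType) m n (M : 'M[F]_m) a :
  eigenvalue (lin_mulmx M : 'M_(m * n)) a -> eigenvalue M a.
Proof.
case/eigenvalueP => w; rewrite -[w]vec_mxK mul_vec_lin /= -linearZ /=.
(* Transposition turns left multiplication by [M] into right multiplication by [M^T]. *)
move: (vec_mx w) => X /(can_inj mxvecK) MX X0; rewrite -eigenvalue_trmx.
apply: (@eigenvalue_lin_mulmxr _ n); apply/eigenvalueP.
exists (mxvec X^T).
  by rewrite mul_vec_lin /= -trmx_mul MX !linearZ.
apply: contraNneq X0 => /(congr1 vec_mx); rewrite mxvecK linear0 => X0.
by rewrite -[X]trmxK X0 trmx0 linear0.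
Qed.

(** Vectorization turns the left-hand side into multiplication by a square matrix [W], a polynomial
    in [F] and [G]; its invertibility gives existence and uniqueness at once. *)
Lemma quadratic_Sylvester_unique (C : numClosedFieldType) m n (c d : C)
    (L : 'M[C]_m) (M : 'M[C]_n) :
    (forall a b, eigenvalue M a -> eigenvalue L b ->
       a + b - c * (b * a) + d * (a ^+ 2 + b ^+ 2) != 0) ->
  forall Y : 'M_(m, n), exists! X : 'M_(m, n),
    X *m M + L *m X - c *: (L *m X *m M) + d *: (X *m M ^+ 2 + L ^+ 2 *m X) = Y.
Proof.
move=> spec Y.
pose F : 'M_(m * n) := lin_mulmxr M; pose G : 'M_(m * n) := lin_mulmx L.
have FG : F *m G = G *m F by exact: lin_mulmx_mulmxr_comm.
have FE X : mxvec X *m F = mxvec (X *m M) by rewrite mul_vec_lin.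
have GE X : mxvec X *m G = mxvec (L *m X) by rewrite mul_vec_lin.
have : row_free (F + G - c *: (F *m G) + d *: (F ^+ 2 + G ^+ 2)).
  apply: (row_free_quadratic FG) => a b /eigenvalue_lin_mulmxr Ma.
  by move=> /eigenvalue_lin_mulmx; apply: spec.
set W := (X in row_free X); rewrite row_free_unit => Wunit.
have WE X : mxvec (X *m M + L *m X - c *: (L *m X *m M)
    + d *: (X *m M ^+ 2 + L ^+ 2 *m X)) = mxvec X *m W.
  rewrite /W !expr2 -!mulmxE {Wunit W}; clearbody F G.
  rewrite !(mulmxDr, mulmxN) -!scalemxAr !mulmxDr !mulmxA !(FE, GE).
  rewrite !(mulmxA L).
  move: (L *m X *m M) (X *m M *m M) (L *m L *m X) => X1 X2 X3.
  by rewrite linearD linearB linearD /= !linearZ /= linearD.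
exists (vec_mx (mxvec Y *m invmx W)); split.
  by apply: (can_inj mxvecK); rewrite WE vec_mxK mulmxKV.
move=> X XY; apply: (can_inj mxvecK).
by rewrite vec_mxK -XY WE mulmxK.
Qed.

Lemma quadratic_Lyapunov_add (K : comNzRingType) n (c d : K)
    (H A A' B B' : 'M[K]_n) :
  H *m B + B' *m H - c *: (A' *m H *m B + B' *m H *m A + B' *m H *m B)
  + d *: (H *m (A *m B + B *m A + B ^+ 2)
          + (B' *m A' + A' *m B' + B' ^+ 2) *m H)
  + (H *m A + A' *m H - c *: (A' *m H *m A)
     + d *: (H *m A ^+ 2 + A' ^+ 2 *m H))
  = H *m (A + B) + (A' + B') *m H - c *: ((A' + B') *m H *m (A + B))
    + d *: (H *m (A + B) ^+ 2 + (A' + B') ^+ 2 *m H).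
Proof.
rewrite !expr2 -!mulmxE !(mulmxDl, mulmxDr) !mulmxA.
(* Once the expanded products are opaque, the identity is linear in them and can be checked
   entrywise. *)
do ![move: (_ *m _) => ?].
by apply/matrixP => i j; rewrite !mxE; ring.
Qed.

Lemma parabola_interior_Lyapunov (R : realType) n (p : R) (M H : 'M[R[i]]_n) :
    0 < p -> posdefmx H ->
    posdefmx (H *m M + M ^t* *m H
      - ((2 * p)^-1)%:C *: (M ^t* *m H *m M)
      + ((4 * p)^-1)%:C *: (H *m M ^+ 2 + (M ^t*) ^+ 2 *m H)) ->
  forall z, eigenvalue M z -> parabola_interior p z.
Proof.
move=> p0 [_ Hpos] [_ Lpos] z; rewrite -eigenvalue_trmx.
(* [eigenvalue] refers to row eigenvectors: [w] is one of [M^T], and its transpose [v] is a column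
   eigenvector of [M]. *)
case/eigenvalueP => w wM w0.
set v := w^T; have v0 : v != 0 by rewrite -(inj_eq trmx_inj) trmxK trmx0.
have Mv : M *m v = z *: v by rewrite -[M]trmxK -trmx_mul wM linearZ.
have vM : v ^t* *m M ^t* = z^* *: v ^t*.
  by rewrite -map_mxM -trmx_mul Mv linearZ /= map_mxZ.
move: (Hpos v v0) (Lpos v v0); rewrite !expr2 -!mulmxE.
rewrite !(mulmxDl, mulmxDr, mulNmx, mulmxN) -!(scalemxAl, scalemxAr).
rewrite !(mulmxDl, mulmxDr) !mulmxA !vM -!(scalemxAl, scalemxAr) !vM.
rewrite -!mulmxA !Mv -!(scalemxAl, scalemxAr) !Mv -!(scalemxAl, scalemxAr).
rewrite !mulmxA; move: (v ^t* *m H *m v) => K; rewrite !mxE /=.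
move: (K 0 0) => [h h'].
case: z {wM Mv vM} => x y.
rewrite !ltcE /= => /andP[/eqP h'0 h0] /andP[_]; rewrite {}h'0.
(* With z = x + iy, the quadratic terms give -(x^2 + y^2)/(2p) + (x^2 - y^2)/(2p) = -y^2/p. *)
set pos := (X in 0 < X).
have -> : pos = h * (2 * x - y ^+ 2 / p) by rewrite /pos; field; rewrite gt_eqF.
rewrite pmulr_rgt0 // subr_gt0 ltr_pdivrMr // /parabola_interior /=.
by rewrite mulrAC.
Qed.

Lemma parabola_interior_no_root (R : realType) (p : R) (a b : R[i]) :
    0 < p -> parabola_interior p a -> parabola_interior p b ->
  a + b - ((2 * p)^-1)%:C * (b * a) + ((4 * p)^-1)%:C * (a ^+ 2 + b ^+ 2) != 0.
Proof.
(* 4p Re(...) = 4p (x + u) + (x - u)^2 - (y - v)^2, which exceeds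
   (y + v)^2 + (x - u)^2 because y^2 < 2px and v^2 < 2pu. *)
move: a b => [x y] [u v]; rewrite /parabola_interior /= => p0 hx hu.
rewrite eq_complex /= negb_and; apply/orP; left; set re := (X in X != 0).
have -> : re = (4 * p * (x + u) + (x - u) ^+ 2 - (y - v) ^+ 2) / (4 * p).
  by rewrite /re; field; rewrite gt_eqF.
rewrite gt_eqF // divr_gt0 ?mulr_gt0 //; have := sqr_ge0 (x - u).
have := sqr_ge0 (y + v); nra.
Qed.

Theorem mainTheorem9 (R : realType) (n : nat) (p : R) (A H B : 'M[R[i]]_n)
  (p_gt0 : 0 < p)
  (spectrumA : forall z : R[i], eigenvalue A z -> parabola_interior p z)
  (H_posdef : posdefmx H)
  (H_eq : H *m A + A ^t* *m H
          - ((2 * p)^-1)%:C *: (A ^t* *m H *m A)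
          + ((4 * p)^-1)%:C *: (H *m A ^+ 2 + (A ^t*) ^+ 2 *m H)
          = 1%:M)
  (B_gt : loewner_gt
     (H *m B + B ^t* *m H
      - ((2 * p)^-1)%:C *:
          (A ^t* *m H *m B + B ^t* *m H *m A + B ^t* *m H *m B)
      + ((4 * p)^-1)%:C *:
          (H *m (A *m B + B *m A + B ^+ 2)
           + (A *m B + B *m A + B ^+ 2) ^t* *m H))
     (- 1%:M)) :
  forall C : 'M[R[i]]_n, exists! X : 'M[R[i]]_n,
    X *m (A + B) + (A + B) ^t* *m X
    - ((2 * p)^-1)%:C *: ((A + B) ^t* *m X *m (A + B))
    + ((4 * p)^-1)%:C *: (X *m (A + B) ^+ 2 + (A ^t* + B ^t*) ^+ 2 *m X)
    = C.
Proof.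
have ctD (X Y : 'M[R[i]]_n) : (X + Y) ^t* = X ^t* + Y ^t*.
  by rewrite linearD map_mxD.
have ctM (X Y : 'M[R[i]]_n) : (X *m Y) ^t* = Y ^t* *m X ^t*.
  by rewrite trmx_mul map_mxM.
have ctX (X : 'M[R[i]]_n) : (X ^+ 2) ^t* = (X ^t*) ^+ 2.
  by rewrite !expr2 -!mulmxE ctM.
have spectrumAB z : eigenvalue (A + B) z -> parabola_interior p z.
  apply: (parabola_interior_Lyapunov p_gt0 H_posdef).
  (* Subtracting -I adds I, which [H_eq] replaces by its left-hand side. *)
  move: B_gt; rewrite /loewner_gt opprK -H_eq !ctD ctX !ctM.
  by rewrite quadratic_Lyapunov_add.
have spectrumABC z : eigenvalue ((A + B) ^t* ) z -> parabola_interior p z.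
  (* The adjoint has the conjugate eigenvalues, and the parabola is symmetric about the real
     axis. *)
  rewrite -map_trmx eigenvalue_trmx -[z](@conjCK R[i]) eigenvalue_map.
  move/spectrumAB; case: z => x y; rewrite /parabola_interior /=.
  by rewrite !sqrrN.
rewrite -ctD; apply: quadratic_Sylvester_unique => a b /spectrumAB Pa.
by move=> /spectrumABC; apply: parabola_interior_no_root.
Qed.
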